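(* Let $\boldsymbol{\mathcal Y}=\boldsymbol{\mathcal X}+\boldsymbol{\mathcal Z}$ with $\boldsymbol{\mathcal Y},\boldsymbol{\mathcal X},\boldsymbol{\mathcal Z}\in\mathbb{R}^{p_1\times\cdots\times p_d}$, where $\boldsymbol{\mathcal X}$ admits a tensor-train (TT) decomposition with ranks $(r_1,\dots,r_{d-1})$. Run TTOI on $\boldsymbol{\mathcal Y}$ with input ranks $(r_1,\dots,r_{d-1})$, and let $t\ge 0$ be an integer. Let $c_0\in(0,1)$ be a fixed constant. (Backward updates) Let $\widetilde U_1^{(2t)}=U_1\in\mathbb{R}^{p_1\times r_1}$ be the left singular space of $[\boldsymbol{\mathcal X}]_1$ and, for $2\le k\le d-1$, let $\widetilde U_k^{(2t)}\in\mathbb{R}^{(p_kr_{k-1})\times r_k}$ be the left singular space of $\bigl(I_{p_k}\otimes(\widehat U^{(2t)})_{\mathrm{prod},k-1}^{(L)\top}\bigr)[\boldsymbol{\mathcal X}]_k$. If $$\bigl\|\sin\Theta(\widehat U_k^{(2t)},\widetilde U_k^{(2t)})\bigr\|\le c_0\quad\text{for all }1\le k\le d-1,$$ then there exists a constant $C_d>0$ depending only on $d$ ($c_0$ being fixed) such that $$\bigl\|\widehat{\boldsymbol{\mathcal X}}^{(2t+1)}-\boldsymbol{\mathcal X}\bigr\|_{\mathrm F}^2\le C_d\Bigl(\sum_{k=1}^{d-1}A_k^{(2t+1)}+B^{(2t+1)}\Bigr),$$ where $$A_k^{(2t+1)}=\Bigl\|(\widehat U^{(2t)})_{\mathrm{prod},k}^{(L)\top}[\boldsymbol{\mathcal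 Z}]_k\bigl((\widehat V^{(2t+1)})_{\mathrm{prod},k+2}^{(R)}\otimes I_{p_{k+1}}\bigr)\Bigr\|_{\mathrm F}^2,\qquad B^{(2t+1)}=\Bigl\|[\boldsymbol{\mathcal Z}]_1(\widehat V^{(2t+1)})_{\mathrm{prod},2}^{(R)}\Bigr\|_{\mathrm F}^2,$$ and $(\widehat V^{(2t+1)})_{\mathrm{prod},k+2}^{(R)}\otimes I_{p_{k+1}}$ is read as $I_{p_d}$ if $k=d-1$. (Forward updates) For $2\le k\le d-1$ let $\widetilde V_k^{(2t+1)}\in\mathbb{R}^{(p_kr_k)\times r_{k-1}}$ be the right singular space of $[\boldsymbol{\mathcal X}]_{k-1}\bigl((\widehat V^{(2t+1)})_{\mathrm{prod},k+1}^{(R)}\otimes I_{p_k}\bigr)$, and let $\widetilde V_d^{(2t+1)}=V_d\in\mathbb{R}^{p_d\times r_{d-1}}$ be the right singular space of $[\boldsymbol{\mathcal X}]_{d-1}$. If $$\bigl\|\sin\Theta(\widehat V_k^{(2t+1)},\widetilde V_k^{(2t+1)})\bigr\|\le c_0\quad\text{for all }2\le k\le d,$$ then there exists a constant $C_d>0$ depending only on $d$ ($c_0$ being fixed) such that $$\bigl\|\widehat{\boldsymbol{\mathcal X}}^{(2t+2)}-\boldsymbol{\mathcal X}\bigr\|_{\mathrm F}^2\le C_d\Bigl(\sum_{k=1}^{d-1}A_k^{(2t+2)}+B^{(2t+2)}\Bigr),$$ where $$A_k^{(2t+2)}=\Bigl\|\bigl(I_{p_k}\otimes(\widehat U^{(2t+2)})_{\mathrm{prod},k-1}^{(L)\top}\bigr)[\boldsymbol{\mathcal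 Z}]_k(\widehat V^{(2t+1)})_{\mathrm{prod},k+1}^{(R)}\Bigr\|_{\mathrm F}^2,\qquad B^{(2t+2)}=\Bigl\|(\widehat U^{(2t+2)})_{\mathrm{prod},d-1}^{(L)\top}[\boldsymbol{\mathcal Z}]_{d-1}\Bigr\|_{\mathrm F}^2,$$ and $I_{p_k}\otimes(\widehat U^{(2t+2)})_{\mathrm{prod},k-1}^{(L)\top}$ is read as $I_{p_1}$ if $k=1$.
   Context: Throughout $d\ge2$, $p_1,\dots,p_d$ and $r_1,\dots,r_{d-1}$ are positive integers, $r_0=r_d=1$. Matrices. $s_1(A)\ge s_2(A)\ge\cdots\ge0$ are the singular values of $A$; $\|A\|$ is the spectral norm, $\|A\|_{\mathrm F}$ the Frobenius norm (also used for tensors, entrywise). $\mathrm{SVD}^L_r(A)$ and $\mathrm{SVD}^R_r(A)$ are the matrices with orthonormal columns consisting of the leading $r$ left, respectively right, singular vectors of $A$ (any choice in case of ties). The ''left (right) singular space'' of a matrix, given with $r$ columns, means the matrix of its leading $r$ left (right) singular vectors. $U\otimes V$ is the usual Kronecker product, with blocks $U_{ij}V$. For $U,\widehat U\in\mathbb{R}^{p\times r}$ with orthonormal columns, $\|\sin\Theta(U,\widehat U)\|=\sqrt{1-s_r(U^\top\widehat U)^2}$. Tensors. The sequential unfolding $[\boldsymbol{\mathcal X}]_k\in\mathbb{R}^{(p_1\cdots p_k)\times(p_{k+1}\cdots p_d)}$ has entry $\boldsymbol{\mathcal X}_{i_1,\dots,i_d}$ at row $i_1+(i_2-1)p_1+\cdots+(i_k-1)p_1\cdots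 p_{k-1}$ and column $i_{k+1}+(i_{k+2}-1)p_{k+1}+\cdots+(i_d-1)p_{k+1}\cdots p_{d-1}$. $\mathrm{Reshape}$ of matrices is column-major: for $A\in\mathbb{R}^{q_1\times q_2q_3}$ and $\widetilde A\in\mathbb{R}^{q_1q_2\times q_3}$, $\widetilde A=\mathrm{Reshape}(A,q_1q_2,q_3)$ and $A=\mathrm{Reshape}(\widetilde A,q_1,q_2q_3)$ iff $\widetilde A_{(i_2-1)q_1+i_1,i_3}=A_{i_1,(i_3-1)q_2+i_2}$ for all indices. $\boldsymbol{\mathcal X}$ admits a TT decomposition with ranks $(r_1,\dots,r_{d-1})$ if there are $G_1\in\mathbb{R}^{p_1\times r_1}$, $\boldsymbol{\mathcal G}_k\in\mathbb{R}^{r_{k-1}\times p_k\times r_k}$ ($2\le k\le d-1$), $G_d\in\mathbb{R}^{p_d\times r_{d-1}}$ with $\boldsymbol{\mathcal X}_{i_1,\dots,i_d}=\sum_{\alpha_1=1}^{r_1}\cdots\sum_{\alpha_{d-1}=1}^{r_{d-1}}G_{1,[i_1,\alpha_1]}\boldsymbol{\mathcal G}_{2,[\alpha_1,i_2,\alpha_2]}\cdots\boldsymbol{\mathcal G}_{d-1,[\alpha_{d-2},i_{d-1},\alpha_{d-1}]}G_{d,[i_d,\alpha_{d-1}]}$. It is understood that $r_k\le r_{k-1}p_k$ and $r_{k-1}\le p_kr_k$ for all $k$, so that all matrices of singular vectors below exist. Sequential products. For $M_i\in\mathbb{R}^{(p_ir_{i-1})\times r_i}$ ($1\le i\le d-1$):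 $M_{\mathrm{prod},1}^{(L)}=M_1$, $M_{\mathrm{prod},k+1}^{(L)}=(I_{p_{k+1}}\otimes M_{\mathrm{prod},k}^{(L)})M_{k+1}$. For $B_j\in\mathbb{R}^{(p_jr_j)\times r_{j-1}}$ ($2\le j\le d$): $B_{\mathrm{prod},d}^{(R)}=B_d$, $B_{\mathrm{prod},k}^{(R)}=(B_{\mathrm{prod},k+1}^{(R)}\otimes I_{p_k})B_k$. TTOI (tensor-train orthogonal iteration) with input $\boldsymbol{\mathcal Y}\in\mathbb{R}^{p_1\times\cdots\times p_d}$ and ranks $r_1,\dots,r_{d-1}$ produces iterates $\widehat{\boldsymbol{\mathcal X}}^{(t)}$, $t=0,1,2,\dots$: Initialization ($t=0$): $R_1^{(0)}=[\boldsymbol{\mathcal Y}]_1$; for $k=1,\dots,d-1$, $\widehat U_k^{(0)}=\mathrm{SVD}^L_{r_k}(R_k^{(0)})$, $\widetilde R_k^{(0)}=\widehat U_k^{(0)\top}R_k^{(0)}$, and if $k<d-1$, $R_{k+1}^{(0)}=\mathrm{Reshape}(\widetilde R_k^{(0)},r_kp_{k+1},p_{k+2}\cdots p_d)$. Then $[\widehat{\boldsymbol{\mathcal X}}^{(0)}]_{d-1}=(\widehat U^{(0)})_{\mathrm{prod},d-1}^{(L)}\widetilde R_{d-1}^{(0)}$. Backward update ($t$ odd): $\widehat V_d^{(t)}=\mathrm{SVD}^R_{r_{d-1}}(\widetilde R_{d-1}^{(t-1)})$; for $k=d-1,\dots,2$, $\widehat V_k^{(t)}=\mathrm{SVD}^R_{r_{k-1}}\bigl(\widetilde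 R_{k-1}^{(t-1)}((\widehat V^{(t)})_{\mathrm{prod},k+1}^{(R)}\otimes I_{p_k})\bigr)$. Then $[\widehat{\boldsymbol{\mathcal X}}^{(t)}]_1=[\boldsymbol{\mathcal Y}]_1(\widehat V^{(t)})_{\mathrm{prod},2}^{(R)}(\widehat V^{(t)})_{\mathrm{prod},2}^{(R)\top}$. Forward update ($t\ge2$ even): $R_1^{(t)}=[\boldsymbol{\mathcal Y}]_1$; for $k=1,\dots,d-1$, $\widehat U_k^{(t)}=\mathrm{SVD}^L_{r_k}\bigl(R_k^{(t)}(\widehat V^{(t-1)})_{\mathrm{prod},k+1}^{(R)}\bigr)$, $\widetilde R_k^{(t)}=\widehat U_k^{(t)\top}R_k^{(t)}$, and if $k<d-1$, $R_{k+1}^{(t)}=\mathrm{Reshape}(\widetilde R_k^{(t)},r_kp_{k+1},p_{k+2}\cdots p_d)$. Then $[\widehat{\boldsymbol{\mathcal X}}^{(t)}]_{d-1}=(\widehat U^{(t)})_{\mathrm{prod},d-1}^{(L)}\widetilde R_{d-1}^{(t)}$. *)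

(* Defs.v *)
From mathcomp Require Import all_boot all_order all_algebra.
From mathcomp Require Import boolp classical_sets reals.
From mathcomp.real_closed Require Export mxtens.

Set Implicit Arguments.
Unset Strict Implicit.
Unset Printing Implicit Defensive.

Import Order.TTheory GRing.Theory Num.Theory.
Local Open Scope ring_scope.

(* The Kronecker product is [A *t B] (mxtens): row index [i * q + j] for row  *)
(* [i] of [A] and row [j] of [B : 'M_(q, _)], i.e. blocks [A i j *: B].       *)

Section SingularValues.
Variable R : realType.

Definition fnorm m n (A : 'M[R]_(m, n)) : R :=
  Num.sqrt (\sum_i \sum_j A i j ^+ 2).

(* A full singular value decomposition A = P diag(s) Q^T; [s 0] is the        *)
(* largest singular value, and [s] is padded by zeros from [minn m n] on.     *)
Definition is_svd m n (A : 'M[R]_(m, n))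
    (P : 'M[R]_m) (s : nat -> R) (Q : 'M[R]_n) : Prop :=
  [/\ P^T *m P = 1%:M, Q^T *m Q = 1%:M,
      (forall i j, (i <= j)%N -> 0 <= s j <= s i),
      (forall i, (minn m n <= i)%N -> s i = 0)
    & A = P *m (\matrix_(i, j) (s i *+ (i == j :> nat))) *m Q^T].

(* The sequence [s] of an SVD exists and depends only on [A], so the choice   *)
(* made by [xget] is harmless. 0-based: [singv A i] is s_{i+1}(A).            *)
Definition singv m n (A : 'M[R]_(m, n)) (i : nat) : R :=
  xget 0 [set x | exists P s Q, is_svd A P s Q /\ x = s i].

(* [U] is one of the possible values of SVD^L_r(A), with [r] the number of    *)
(* columns of [U]; right multiplication by [pid_mx r] keeps the first [r]     *)
(* columns. Similarly for [is_svdR] and SVD^R_r(A).                           *)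
Definition is_svdL m n r (A : 'M[R]_(m, n)) (U : 'M[R]_(m, r)) : Prop :=
  exists P s Q, [/\ is_svd A P s Q, (r <= m)%N & U = P *m pid_mx r].

Definition is_svdR m n r (A : 'M[R]_(m, n)) (V : 'M[R]_(n, r)) : Prop :=
  exists P s Q, [/\ is_svd A P s Q, (r <= n)%N & V = Q *m pid_mx r].

Definition sinTheta m r (U Uh : 'M[R]_(m, r)) : R :=
  Num.sqrt (1 - singv (U^T *m Uh) r.-1 ^+ 2).

(* Column-major reshape: entry (i2 q1 + i1, i3) of the result is entry        *)
(* (i1, i3 q2 + i2) of [A] (0-based indices).                                 *)
Definition reshape_mx q1 q2 q3 (A : 'M[R]_(q1, q3 * q2)) : 'M[R]_(q2 * q1, q3) :=
  \matrix_(i, j) A (mxtens_unindex i).2 (mxtens_index (j, (mxtens_unindex i).1)).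

End SingularValues.

(* Modes are numbered from 0: [p k] is the dimension p_{k+1}, whereas [r k]   *)
(* is the rank r_k. Values [p k] for k >= d and [r k] for k > d are unused.   *)

Definition tt_dims (d : nat) (p r : nat -> nat) : Prop :=
  [/\ forall k, (k < d)%N -> (0 < p k)%N,
      r 0 = 1%N, r d = 1%N,
      forall k, (0 < k < d)%N -> (0 < r k)%N
    & forall k, (k < d)%N ->
        (r k.+1 <= r k * p k)%N /\ (r k <= p k * r k.+1)%N].

(* [hdim p k] is the product of the first [k] dimensions, [tdim p k n] that   *)
(* of the [n] dimensions p k, ..., p (k + n - 1). The recursions follow the   *)
(* Kronecker factors, so that no cast is needed below.                        *)
Fixpoint hdim (p : nat -> nat) k : nat :=
  if k is k'.+1 then (p k' * hdim p k')%N else 1%N.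

Fixpoint tdim (p : nat -> nat) k n : nat :=
  if n is n'.+1 then (tdim p k.+1 n' * p k)%N else 1%N.

Definition midx (d : nat) (p : nat -> nat) : finType :=
  {dffun forall l : 'I_d, 'I_(p l)}.

Definition tensor (R : realType) (d : nat) (p : nat -> nat) :=
  {ffun midx d p -> R}.

Section Tensors.
Variables (R : realType) (d : nat) (p r : nat -> nat).
Implicit Type X : tensor R d p.

Definition tnorm X : R := Num.sqrt (\sum_x X x ^+ 2).

Definition rowidx k (x : midx d p) : nat :=
  (\sum_(l < d | l < k) x l * \prod_(m < l) p m)%N.

Definition colidx k (x : midx d p) : nat :=
  (\sum_(l < d | k <= l) x l * \prod_(k <= m < l) p m)%N.

(* [unfold X k n], used with k + n = d, is the sequential unfolding [X]_k:    *)
(* the sum ranges over the single multi-index placed at position (i, j).      *)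
(* For k = 0 it is the row vector of all the entries of [X].                  *)
Definition unfold X k n : 'M[R]_(hdim p k, tdim p k n) :=
  \matrix_(i, j) \sum_(x | (rowidx k x == i) && (colidx k x == j)) X x.

(* All [d] cores have order 3 here; the rank multi-index [a] has components   *)
(* a 0, ..., a d, the extreme ones taking a single value since r 0 = r d = 1. *)
Definition admits_TT X : Prop :=
  exists G : forall k, 'I_(r k) -> 'I_(p k) -> 'I_(r k.+1) -> R,
  forall x : midx d p,
    X x = \sum_(a : {dffun forall k : 'I_d.+1, 'I_(r k)})
            \prod_(k < d) G k (a (widen_ord (leqnSn d) k)) (x k) (a (lift ord0 k)).

(* Families of factors, numbered like the modes: [U k] is U_{k+1} and [V k]   *)
(* is V_{k+1}.                                                                *)
Definition lfactors := forall k, 'M[R]_(p k * r k, r k.+1).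
Definition rfactors := forall k, 'M[R]_(r k.+1 * p k, r k).

(* [lprod U k] is U_{prod,k}^(L). It starts at k = 0 with the 1 x 1 identity, *)
(* of type ['M_(1, r 0)] where r 0 = 1, so that [lprod U 1] is U_1 and        *)
(* 1%:M *t (lprod U 0)^T is I_{p_1}.                                          *)
Fixpoint lprod (U : lfactors) k : 'M[R]_(hdim p k, r k) :=
  match k with
  | 0 => const_mx 1
  | k'.+1 => (1%:M *t lprod U k') *m U k'
  end.

(* [rprod V k n], used with k + n = d, is V_{prod,k+1}^(R), a product of [n]  *)
(* factors. It starts at k = d, n = 0 with the 1 x 1 identity, of type        *)
(* ['M_(1, r d)] where r d = 1, so that [rprod V d.-1 1] is V_d and           *)
(* rprod V d 0 *t 1%:M is I_{p_d}.                                            *)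
Fixpoint rprod (V : rfactors) k n : 'M[R]_(tdim p k n, r k) :=
  match n with
  | 0 => const_mx 1
  | n'.+1 => (rprod V k.+1 n' *t 1%:M) *m V k
  end.

(* [tres Y U k n], used with k + n = d, is R~_k. It starts at k = 0 with [Y]  *)
(* as a row vector, whose reshape is [Y]_1 = R_1.                             *)
Fixpoint tres (Y : tensor R d p) (U : lfactors) k n : 'M[R]_(r k, tdim p k n) :=
  match k with
  | 0 => const_mx 1 *m unfold Y 0 n
  | k'.+1 => (U k')^T *m reshape_mx (tres Y U k' n.+1)
  end.

(* [res Y U k n], used with k + n + 1 = d, is R_{k+1}. *)
Definition res (Y : tensor R d p) (U : lfactors) k n :
    'M[R]_(p k * r k, tdim p k.+1 n) :=
  reshape_mx (tres Y U k n.+1).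

(* [U t] (t even), [V t] (t odd) and [Xh t] are the factors and iterates of a *)
(* run of TTOI on [Y]; it is a relation because of ties between singular      *)
(* vectors. [U t] for odd t and [V t] for even t are unused.                  *)
Definition is_TTOI (Y : tensor R d p)
    (U : nat -> lfactors) (V : nat -> rfactors) (Xh : nat -> tensor R d p) : Prop :=
  [/\ (forall k, (k < d.-1)%N ->
         is_svdL (res Y (U 0) k (d - k.+1)) (U 0 k))
      /\ unfold (Xh 0) d.-1 1 = lprod (U 0) d.-1 *m tres Y (U 0) d.-1 1,
      (forall t, odd t ->
         (forall k, (0 < k < d)%N ->
            let n := (d - k.+1)%N in
            is_svdR (tres Y (U t.-1) k n.+1 *m (rprod (V t) k.+1 n *t 1%:M))
                    (V t k))
         /\ unfold (Xh t) 1 d.-1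
            = unfold Y 1 d.-1 *m rprod (V t) 1 d.-1 *m (rprod (V t) 1 d.-1)^T)
    & (forall t, (2 <= t)%N -> ~~ odd t ->
         (forall k, (k < d.-1)%N ->
            let n := (d - k.+1)%N in
            is_svdL (res Y (U t) k n *m rprod (V t.-1) k.+1 n) (U t k))
         /\ unfold (Xh t) d.-1 1 = lprod (U t) d.-1 *m tres Y (U t) d.-1 1)].

(* With indices shifted by one, [termA_bwd] and [termA_fwd] at k are A_{k+1}. *)
Definition termA_bwd (Z : tensor R d p) (U : lfactors) (V : rfactors) k : R :=
  let n := (d - k.+2)%N in
  fnorm ((lprod U k.+1)^T *m unfold Z k.+1 n.+1 *m (rprod V k.+2 n *t 1%:M)) ^+ 2.

Definition termB_bwd (Z : tensor R d p) (V : rfactors) : R :=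
  fnorm (unfold Z 1 d.-1 *m rprod V 1 d.-1) ^+ 2.

Definition termA_fwd (Z : tensor R d p) (U : lfactors) (V : rfactors) k : R :=
  let n := (d - k.+1)%N in
  fnorm ((1%:M *t (lprod U k)^T) *m unfold Z k.+1 n *m rprod V k.+1 n) ^+ 2.

Definition termB_fwd (Z : tensor R d p) (U : lfactors) : R :=
  fnorm ((lprod U d.-1)^T *m unfold Z d.-1 1) ^+ 2.

End Tensors.

Arguments lfactors : clear implicits.
Arguments rfactors : clear implicits.
Arguments admits_TT {R d p} r X.

(* Main.v *)
Require Import Defs.
From mathcomp Require Import all_boot all_order all_algebra.
From mathcomp Require Import boolp classical_sets reals.
From mathcomp Require Import zify.
Import Order.TTheory GRing.Theory Num.Theory.
Local Open Scope ring_scope.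
Set Implicit Arguments.
Unset Strict Implicit.
Unset Printing Implicit Defensive.

(** The squared error of an iterate is an orthogonal sum. For a backward
    iterate, let W be the product of all the right factors. It has orthonormal
    columns, and the iterate unfolds to (X + Z) W W^T; hence, by Pythagoras,
    the squared error is |X|^2 - |X W|^2 + |Z W|^2, where the last term is B
    ([projection_errorr]).

    The loss |X|^2 - |X W|^2 telescopes. Since the products of right factors
    are nested and reshaping preserves the Frobenius norm, it is the sum over k
    of the losses |A|^2 - |A V_k|^2, where A is the k-th unfolding of X
    compressed by the right factors after k. One such loss is small for two
    reasons, combined in [truncation_loss].
    - Let L be the product of the left factors that precede k. The matrix
      L^T (A + E) whose right singular vectors make up V_k has just as many
      rows as V_k has columns, so that V_k V_k^T fixes it: what the truncation
      removes from L^T A is, up to sign, what it removes from L^T E, hence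
      at most |L^T E|, whose square is one of the terms A_k of the bound.
    - Passing from L^T A to A costs a constant factor only. X has TT rank
      r_k, so that the k-th unfolding, even after compression on the left, has
      rank at most r_k ([rank_unfold]), and its column space lies in the
      reference singular space ([svdL_proj]). The bound c on the sine of the
      angle makes the corresponding left factor multiply squared norms on that
      space by at least 1 - c^2 ([sinTheta_lower]); by induction on k, L^T
      multiplies them by at least (1 - c^2)^k on the column space of the
      unfolding ([lprod_lower]).

    Altogether the constant (1 - c^2)^-d works. The forward case is the same
    argument with left and right exchanged. No perturbation bound on singular
    vectors is involved. *)

(** * The Frobenius norm and orthogonal projections *)

Section Frobenius.
Variable R : realType.

Definition sqnorm m n (A : 'M[R]_(m, n)) : R := \sum_i \sum_j A i j ^+ 2.

Lemma sqnorm_ge0 m n (A : 'M[R]_(m, n)) : 0 <= sqnorm A.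
Proof. by apply: sumr_ge0 => i _; apply: sumr_ge0 => j _; exact: sqr_ge0. Qed.

Lemma fnorm_sqr m n (A : 'M[R]_(m, n)) : fnorm A ^+ 2 = sqnorm A.
Proof. by rewrite /fnorm sqr_sqrtr //; exact: sqnorm_ge0. Qed.

Lemma sqnorm_tr m n (A : 'M[R]_(m, n)) : sqnorm A^T = sqnorm A.
Proof.
rewrite /sqnorm exchange_big; apply: eq_bigr => i _; apply: eq_bigr => j _.
by rewrite mxE.
Qed.

Lemma sqnormE m n (A : 'M[R]_(m, n)) : sqnorm A = \tr (A *m A^T).
Proof.
apply: eq_bigr => i _; rewrite mxE; apply: eq_bigr => j _.
by rewrite mxE expr2.
Qed.

Lemma sqnormN m n (A : 'M[R]_(m, n)) : sqnorm (- A) = sqnorm A.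
Proof. by rewrite !sqnormE linearN /= mulNmx mulmxN opprK. Qed.

Lemma sqnorm_pythagoras m n (A B : 'M[R]_(m, n)) :
  A *m B^T = 0 -> sqnorm (A + B) = sqnorm A + sqnorm B.
Proof.
move=> AB0; have BA0 : B *m A^T = 0 by rewrite -[LHS]trmxK trmx_mul trmxK AB0 trmx0.
by rewrite !sqnormE linearD /= mulmxDl !mulmxDr AB0 BA0 addr0 add0r linearD.
Qed.

Lemma sqnorm_isometry m n k (W : 'M[R]_(m, n)) (A : 'M_(n, k)) :
  W^T *m W = 1%:M -> sqnorm (W *m A) = sqnorm A.
Proof.
move=> WW; rewrite -[LHS]sqnorm_tr -[RHS]sqnorm_tr !sqnormE !trmxK trmx_mul.
by rewrite -mulmxA (mulmxA _ W) WW mul1mx.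
Qed.

(** Pythagoras for the projection W W^T: its complement accounts exactly for
    the norm lost when compressing by W^T. *)
Lemma sqnorm_split m n k (W : 'M[R]_(m, n)) (A : 'M_(m, k)) :
  W^T *m W = 1%:M ->
  sqnorm A = sqnorm ((1%:M - W *m W^T) *m A) + sqnorm (W^T *m A).
Proof.
move=> WW; rewrite -(sqnorm_isometry (W^T *m A) WW).
rewrite -[LHS]sqnorm_tr -[X in X + _]sqnorm_tr -[X in _ + X]sqnorm_tr.
rewrite -sqnorm_pythagoras.
  by rewrite -linearD /= mulmxBl mul1mx mulmxA subrK.
rewrite trmxK trmx_mul -mulmxA (mulmxA _ W) linearB /= trmx1 trmx_mul trmxK.
by rewrite mulmxBl mul1mx -mulmxA WW mulmx1 subrr mul0mx mulmx0.
Qed.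

End Frobenius.

(** * Spaces of leading singular vectors *)

Section SingularSubspaces.
Variable R : realType.

Lemma is_svd_tr m n (A : 'M[R]_(m, n)) P s Q :
  is_svd A P s Q -> is_svd A^T Q s P.
Proof.
case=> PP QQ sD s0 ->; split=> //; first by move=> i; rewrite minnC; exact: s0.
rewrite !trmx_mul trmxK mulmxA; congr (_ *m _ *m _); apply/matrixP => i j.
by rewrite !mxE eq_sym; case: eqP => // ->.
Qed.

Lemma svdR_tr m n r (A : 'M[R]_(m, n)) (V : 'M_(n, r)) :
  is_svdR A V -> is_svdL A^T V.
Proof. by case=> P [s [Q [/is_svd_tr sA rn VE]]]; exists Q, s, P. Qed.

Lemma svdL_tr m n r (A : 'M[R]_(m, n)) (U : 'M_(m, r)) :
  is_svdL A U -> is_svdR A^T U.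
Proof. by case=> P [s [Q [/is_svd_tr sA rm UE]]]; exists Q, s, P. Qed.

Lemma svdL_orthonormal m n r (A : 'M[R]_(m, n)) (U : 'M_(m, r)) :
  is_svdL A U -> U^T *m U = 1%:M.
Proof.
case=> P [s [Q [[PP _ _ _ _] rm ->]]].
rewrite trmx_mul -mulmxA (mulmxA _ P) PP mul1mx tr_pid_mx mul_pid_mx.
by rewrite minnn (minn_idPr rm) pid_mx_1.
Qed.

(** If the (r+1)-st singular value were nonzero, the leading r+1 ones would
    form an invertible diagonal block of [P^T *m A *m Q]. *)
Lemma svd_rank m n r (A : 'M[R]_(m, n)) P s Q :
  is_svd A P s Q -> (\rank A <= r)%N -> forall i, (r <= i)%N -> s i = 0.
Proof.
case=> PP QQ sD s0 AE rkA.
suff sr0 : s r = 0.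
  by move=> i /sD /andP[si0 sir]; apply/eqP; rewrite eq_le si0 -sr0 sir.
case: (leqP (minn m n) r) => [/s0 //|]; rewrite leq_min => /andP[rm rn].
apply/eqP/negPn/negP => sr0; move: rkA; apply/negP; rewrite -ltnNge.
pose f := widen_ord rm; pose g := widen_ord rn.
pose D : 'M[R]_(m, n) := \matrix_(i, j) (s i *+ (i == j :> nat)).
have DE : D = P^T *m A *m Q.
  by rewrite AE -/D !mulmxA PP mul1mx -mulmxA QQ mulmx1.
have ED : diag_mx (\row_(i < r.+1) s i) = rowsub f 1%:M *m D *m colsub g 1%:M.
  rewrite mul_rowsub_mx mul1mx mulmx_colsub mulmx1.
  by apply/matrixP => i j; rewrite !mxE.
have rkE : \rank (diag_mx (\row_(i < r.+1) s i)) = r.+1.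
  rewrite mxrank_unit // unitmxE det_diag unitfE prodf_seq_neq0.
  apply/allP => i _ /=; rewrite mxE gt_eqF //.
  have := ltn_ord i; rewrite ltnS => /sD /andP[_]; apply: lt_le_trans.
  by rewrite lt_neqAle eq_sym sr0; case/andP: (sD r r (leqnn r)).
rewrite -rkE ED DE.
apply: leq_trans (mxrankM_maxl _ _) _; apply: leq_trans (mxrankM_maxr _ _) _.
by apply: leq_trans (mxrankM_maxl _ _) _; apply: mxrankM_maxr.
Qed.

(** Singular vectors beyond the rank have zero singular value, so that nothing
    of [A] is lost by keeping the leading [r] of them. *)
Lemma svdL_proj m n r (A : 'M[R]_(m, n)) (U : 'M_(m, r)) :
  is_svdL A U -> (\rank A <= r)%N -> U *m U^T *m A = A.
Proof.
case=> P [s [Q [sA rm ->]]] /(svd_rank sA) s0.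
case: sA => PP _ _ _ ->; rewrite trmx_mul tr_pid_mx !mulmxA.
congr (_ *m _); rewrite -!mulmxA; congr (_ *m _).
rewrite (mulmxA P^T) PP mul1mx mulmxA mul_pid_mx !minnn.
apply/matrixP => i j; rewrite !mxE (bigD1 i) //= big1 => [|k ki].
  rewrite !mxE eqxx /= addr0; case: ltnP => [|/s0 ->]; first by rewrite mul1r.
  by rewrite mul0rn mulr0.
by rewrite !mxE [X in X && _]eq_sym [X in X && _](negPf ki) mul0r.
Qed.

(** Since [W] is an isometry onto a space containing the columns of [A], the
    squared norm of [U^T *m A] is at least that of [A] times the squared
    smallest singular value of [U^T *m W], and this square is at least
    [1 - c ^+ 2]. *)
Lemma sinTheta_lower m n r (U W : 'M[R]_(m, r)) (A : 'M_(m, n)) c :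
  0 < c < 1 -> sinTheta U W <= c ->
  W^T *m W = 1%:M -> W *m W^T *m A = A ->
  (1 - c ^+ 2) * sqnorm A <= sqnorm (U^T *m A).
Proof.
move=> /andP[c0 c1] sc WW AE.
pose N := W^T *m A; have NE : A = W *m N by rewrite mulmxA.
rewrite NE sqnorm_isometry // mulmxA; move: (N) => {NE AE}B {N A}.
move: sc; rewrite /sinTheta; set x := singv _ _ => sc.
(* The square root in [sinTheta] is 0 on negative numbers, so the bound is
   read off separately in that case. *)
have c2 : 0 < 1 - c ^+ 2 by rewrite subr_gt0 expr_lt1 // ltW.
have xc : 1 - c ^+ 2 <= x ^+ 2.
  rewrite lerBlDr -lerBlDl.
  case: (leP 0 (1 - x ^+ 2)) => [h|h]; last by apply: le_trans (ltW h) (sqr_ge0 c).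
  by rewrite -(sqr_sqrtr h) lerXn2r // nnegrE ?sqrtr_ge0 // ltW.
have x0 : x != 0 by apply: contraTneq xc => ->; rewrite expr0n -ltNge.
(* [singv] takes its default value 0 when no decomposition exists; as it is
   nonzero here, it is the last diagonal entry of some decomposition. *)
have [P [s [Q [[PP QQ sD _ ->] xE]]]] :
    exists P s Q, is_svd (U^T *m W) P s Q /\ x = s r.-1.
  move: x0; rewrite /x /singv; case: xgetP => [y _ [P [s [Q sQ]]] _|_]; last by rewrite eqxx.
  by exists P, s, Q.
rewrite -!mulmxA sqnorm_isometry //.
have QQt : Q^T^T *m Q^T = 1%:M by rewrite trmxK; apply: mulmx1C.
rewrite -(sqnorm_isometry B QQt); move: (Q^T *m B) => C.
rewrite /sqnorm mulr_sumr; apply: ler_sum => i _; rewrite mulr_sumr.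
apply: ler_sum => j _; rewrite mxE (bigD1 i) //= big1 => [|k ki]; last first.
  by rewrite mxE eq_sym (negPf (_ : k != i :> nat)) // mul0r.
rewrite mxE eqxx addr0 exprMn ler_wpM2r ?sqr_ge0 //; apply: le_trans xc _.
have /sD /andP[sr0 sri] : (i <= r.-1)%N by rewrite -ltnS (ltn_predK (ltn_ord i)).
by rewrite xE lerXn2r // nnegrE // (le_trans sr0).
Qed.

End SingularSubspaces.

(** * Reshaping *)

Section Reshape.
Variable R : realType.

Lemma sum_mxtens m n (F : 'I_(m * n) -> R) :
  \sum_k F k = \sum_i \sum_j F (mxtens_index (i, j)).
Proof.
rewrite pair_big (reindex (@mxtens_index m n)) /=; last first.
  by exists (@mxtens_unindex m n) => k _; rewrite (mxtens_indexK, mxtens_unindexK).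
by apply: eq_bigr => -[].
Qed.

Lemma reshapeE q1 q2 q3 (A : 'M[R]_(q1, q3 * q2)) i1 i2 j :
  reshape_mx A (mxtens_index (i2, i1)) j = A i1 (mxtens_index (j, i2)).
Proof. by rewrite mxE mxtens_indexK. Qed.

Lemma sqnorm_reshape q1 q2 q3 (A : 'M[R]_(q1, q3 * q2)) :
  sqnorm (reshape_mx A) = sqnorm A.
Proof.
rewrite /sqnorm sum_mxtens exchange_big; apply: eq_bigr => i _ /=.
rewrite sum_mxtens exchange_big; apply: eq_bigr => j _; apply: eq_bigr => k _ /=.
by rewrite reshapeE.
Qed.

(** Reshaping moves the index [i2] from the columns to the rows; a product
    acting on the other row index commutes with it. *)
Lemma reshape_mull q1 q2 q3 m (L : 'M[R]_(m, q1)) (A : 'M_(q1, q3 * q2)) :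
  reshape_mx (L *m A) = (1%:M *t L) *m reshape_mx A.
Proof.
apply/matrixP => i j; case: (mxtens_indexP i) => i2 i1.
rewrite reshapeE !mxE sum_mxtens (bigD1 i2) //= [X in _ + X]big1 => [|k ki].
  by rewrite addr0; apply: eq_bigr => l _; rewrite tensmxE mxE eqxx mul1r reshapeE.
by apply: big1 => l _; rewrite tensmxE mxE eq_sym (negPf ki) !mul0r.
Qed.

Lemma reshape_mulr q1 q2 q3 m (A : 'M[R]_(q1, q3 * q2)) (N : 'M_(q3, m)) :
  reshape_mx (A *m (N *t 1%:M)) = reshape_mx A *m N.
Proof.
apply/matrixP => i j; case: (mxtens_indexP i) => i2 i1.
rewrite reshapeE !mxE sum_mxtens; apply: eq_bigr => k _.
rewrite (bigD1 i2) //= big1 => [|l li].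
  by rewrite addr0 reshapeE tensmxE mxE eqxx mulr1.
by rewrite tensmxE mxE (negPf li) !mulr0.
Qed.

Lemma tensmx11 m n : 1%:M *t 1%:M = 1%:M :> 'M[R]_(m * n).
Proof.
apply/matrixP => i j; case: (mxtens_indexP i) => i1 i2.
case: (mxtens_indexP j) => j1 j2; rewrite tensmxE !mxE.
rewrite (can_eq (@mxtens_indexK m n)) xpair_eqE.
by do 2!case: eqP; rewrite ?mul0r ?mulr0 ?mulr1.
Qed.

End Reshape.

(** * Sequential unfoldings *)

Section Unfolding.
Variables (R : realType) (d : nat) (p : nat -> nat).
Implicit Types (X : tensor R d p) (x y : midx d p) (k n : nat).

Lemma hdimE k : hdim p k = \prod_(m < k) p m.
Proof. by elim: k => [|k IH]; rewrite ?big_ord0 // big_ord_recr /= IH mulnC. Qed.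

(** [rowidx] and [colidx] are mixed-radix expansions: here mode [k] is the most
    significant digit, in [colidxS] it is the least significant one. *)
Lemma rowidxS k x (hk : (k < d)%N) :
  rowidx k.+1 x = (x (Ordinal hk) * hdim p k + rowidx k x)%N.
Proof.
rewrite /rowidx (bigD1 (Ordinal hk)) //= hdimE; congr addn.
by apply: eq_bigl => l; rewrite -val_eqE /= ltnS andbC -ltn_neqAle.
Qed.

Lemma colidxS k x (hk : (k < d)%N) :
  colidx k x = (colidx k.+1 x * p k + x (Ordinal hk))%N.
Proof.
rewrite /colidx (bigD1 (Ordinal hk)) //= big_geq // muln1 addnC; congr addn.
rewrite big_distrl /=; apply: eq_big => [l|l /andP[kl lk]].
  by rewrite -val_eqE /= andbC eq_sym -ltn_neqAle.
by rewrite big_ltn; [lia | rewrite ltn_neqAle kl eq_sym lk].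
Qed.

Lemma rowidx_lt k x : (k <= d)%N -> (rowidx k x < hdim p k)%N.
Proof.
elim: k => [|k IH] kd; first by rewrite /rowidx big1.
rewrite (rowidxS x kd) /=; have := IH (ltnW kd); have := ltn_ord (x (Ordinal kd)).
by move=> /=; nia.
Qed.

Lemma colidx_lt k n x : (k + n = d)%N -> (colidx k x < tdim p k n)%N.
Proof.
elim: n k => [|n IH] k kn.
  rewrite /colidx big1 // => l; have := ltn_ord l; lia.
have kd : (k < d)%N by lia.
have kn' : (k.+1 + n = d)%N by lia.
rewrite (colidxS x kd) /=; have := IH _ kn'; have := ltn_ord (x (Ordinal kd)).
by move=> /=; nia.
Qed.

Lemma rowidx_inj k x y : (k <= d)%N -> rowidx k x = rowidx k y ->
  forall l : 'I_d, (l < k)%N -> x l = y l.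
Proof.
elim: k => [//|k IH] kd; rewrite !(rowidxS _ kd) => /eqP.
rewrite eq_addl_mul ?rowidx_lt 1?ltnW // xpair_eqE => /andP[/eqP xy /eqP/IH H] l.
rewrite ltnS leq_eqVlt => /orP[/eqP lk|]; last by apply: H; exact: ltnW.
have -> : l = Ordinal kd by apply: val_inj.
exact: val_inj.
Qed.

Lemma colidx_inj k n x y : (k + n = d)%N -> colidx k x = colidx k y ->
  forall l : 'I_d, (k <= l)%N -> x l = y l.
Proof.
elim: n k => [|n IH] k kn; first by move=> _ l; have := ltn_ord l; lia.
have kd : (k < d)%N by lia.
have kn' : (k.+1 + n = d)%N by lia.
rewrite !(colidxS _ kd) => /eqP.
rewrite eq_addl_mul ?ltn_ord // xpair_eqE => /andP[/eqP/(IH _ kn') H /eqP xy] l.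
rewrite leq_eqVlt => /orP[/eqP lk|]; last exact: H.
have -> : l = Ordinal kd by apply: val_inj.
exact: val_inj.
Qed.

Lemma unfoldD X Y k n : unfold (X + Y) k n = unfold X k n + unfold Y k n.
Proof.
apply/matrixP => i j; rewrite !mxE -big_split /=.
by apply: eq_bigr => x _; rewrite ffunE.
Qed.

Lemma unfoldB X Y k n : unfold (X - Y) k n = unfold X k n - unfold Y k n.
Proof.
apply/matrixP => i j; rewrite !mxE -sumrB /=.
by apply: eq_bigr => x _; rewrite !ffunE.
Qed.

(** Both indices of an unfolding are Kronecker indices, so that moving mode [k]
    from the columns to the rows is one column-major reshape. *)
Lemma reshape_unfold X k n : (k + n.+1 = d)%N ->
  reshape_mx (unfold X k n.+1) = unfold X k.+1 n.
Proof.
move=> kn; have kd : (k < d)%N by lia.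
apply/matrixP => i j; case: (mxtens_indexP i) => i2 i1.
rewrite reshapeE !mxE; apply: eq_bigl => x /=.
rewrite (rowidxS x kd) (colidxS x kd) !eq_addl_mul ?ltn_ord ?rowidx_lt //; try exact: ltnW.
rewrite !xpair_eqE; case: (rowidx k x == i1); rewrite ?andbF ?andbT //=.
by rewrite andbC.
Qed.

(** By [reshape_unfold] it suffices to treat the row vector of all entries,
    where each position holds at most one entry of [X]. *)
Lemma tnorm_unfold X k n : (k + n = d)%N -> tnorm X ^+ 2 = sqnorm (unfold X k n).
Proof.
rewrite /tnorm sqr_sqrtr; last by apply: sumr_ge0 => x _; exact: sqr_ge0.
elim: k n => [|k IH] n kn; last first.
  have kn' : (k + n.+1 = d)%N by lia.
  by rewrite (IH _ kn') -sqnorm_reshape reshape_unfold.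
rewrite /sqnorm big_ord1.
rewrite (partition_big (fun x => Ordinal (colidx_lt x kn)) xpredT) //=.
apply: eq_bigr => j _; rewrite mxE.
have E x : (rowidx 0 x == (0 : 'I_1)) && (colidx 0 x == j)
           = (Ordinal (colidx_lt x kn) == j).
  by rewrite -val_eqE /= [rowidx 0 x]big1.
rewrite (eq_bigl _ _ E).
case: (pickP (fun x => Ordinal (colidx_lt x kn) == j)) => [x xj|none]; last first.
  by rewrite !big_pred0 // expr0n.
have E' : (fun y => Ordinal (colidx_lt y kn) == j) =1 pred1 x.
  move=> y /=; apply/idP/eqP => [yj|-> //]; apply/ffunP => l.
  apply: (colidx_inj kn) => //; move: xj yj; rewrite -!val_eqE /=.
  by move=> /eqP -> /eqP ->.
by rewrite !(big_pred1 x).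
Qed.

End Unfolding.

(** * The rank of an unfolding is bounded by the TT rank *)

Section TTRank.

Section Splice.
Variables (m : nat) (q : nat -> nat).
Local Notation dfun := {dffun forall l : 'I_m, 'I_(q l)}.
Implicit Types (a b : dfun) (k : nat).

Definition splice k a b : dfun :=
  finfun (fun l : 'I_m => if (l < k)%N then a l else b l).

Lemma splice_lt k a b (l : 'I_m) : (l < k)%N -> splice k a b l = a l.
Proof. by rewrite ffunE => ->. Qed.

Lemma splice_ge k a b (l : 'I_m) : (k <= l)%N -> splice k a b l = b l.
Proof. by rewrite ffunE ltnNge => ->. Qed.

Lemma spliceK k a b : splice k (splice k a b) (splice k b a) = a.
Proof.
by apply/ffunP => l; case: (ltnP l k) => lk; [rewrite !splice_lt | rewrite !splice_ge].
Qed.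

(** When [F] only looks at the components up to [o] and [H] at those from [o]
    on, the sum of [F a * H a] over the [a] with a prescribed component at [o]
    factors. Exchanging the tails of a pair [(a, b)] is an involution that
    turns [F a * H b] into [F * H] evaluated at a single multi-index; the
    other one is then free, hence the cardinal. *)
Lemma separable_sum (R : comNzRingType) (o : 'I_m) (al : 'I_(q o)) (F H : dfun -> R) :
  (forall a b, (forall l : 'I_m, (l <= o)%N -> a l = b l) -> F a = F b) ->
  (forall a b, (forall l : 'I_m, (o <= l)%N -> a l = b l) -> H a = H b) ->
  (\sum_(a : dfun | a o == al) F a) * (\sum_(b : dfun | b o == al) H b)
  = (\sum_(a : dfun | a o == al) F a * H a) *+ #|[pred a : dfun | a o == al]|.
Proof.
move=> Fo Ho; rewrite big_distrlr pair_big /=.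
pose s (u : dfun * dfun) := (splice o u.1 u.2, splice o u.2 u.1).
have sI : injective s.
  by apply: (can_inj (g := s)) => -[a b]; rewrite /s /= !spliceK.
transitivity (\sum_(u : dfun * dfun | (u.1 o == al) && (u.2 o == al)) F u.1 * H u.1);
    last first.
  rewrite -(pair_big (fun a : dfun => a o == al)
    (fun b : dfun => b o == al) (fun a b => F a * H a)) /=.
  by rewrite -sumrMnl; apply: eq_bigr => a _; rewrite sumr_const.
rewrite [RHS](reindex_inj sI) /=; apply: eq_big => [[a b]|[a b] /andP[/eqP ao /eqP bo]] /=.
  by rewrite !splice_ge // andbC.
congr (_ * _); last by apply: Ho => l ol; rewrite splice_ge.
apply: Fo => l; rewrite leq_eqVlt => /orP[/eqP/val_inj ->|lo]; last by rewrite splice_lt.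
by rewrite splice_ge // bo.
Qed.

End Splice.

Variables (R : realType) (d : nat) (p r : nat -> nat).
Implicit Types (X : tensor R d p) (x y : midx d p) (k n : nat).

(** The cores before [k] and those from [k] on share only the rank index
    between them. *)
Lemma admits_TT_split X k : (k <= d)%N -> admits_TT r X ->
  exists f g : midx d p -> 'I_(r k) -> R,
  [/\ forall x, X x = \sum_al f x al * g x al,
      forall x y, (forall l : 'I_d, (l < k)%N -> x l = y l) -> f x = f y
    & forall x y, (forall l : 'I_d, (k <= l)%N -> x l = y l) -> g x = g y].
Proof.
move=> kd [G XE]; have kd1 : (k < d.+1)%N by [].
pose o : 'I_d.+1 := Ordinal kd1.
pose rk := {dffun forall l : 'I_d.+1, 'I_(r l)}.
pose term (x : midx d p) (a : rk) (l : 'I_d) :=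
  G l (a (widen_ord (leqnSn d) l)) (x l) (a (lift ord0 l)).
pose F x a := \prod_(l < d | (l < k)%N) term x a l.
pose H x a := \prod_(l < d | ~~ (l < k)%N) term x a l.
pose N (al : 'I_(r o)) : R := #|[pred a : rk | a o == al]|%:R.
exists (fun x al => (N al)^-1 * \sum_(a : rk | a o == al) F x a).
exists (fun x al => \sum_(a : rk | a o == al) H x a); split.
- move=> x; rewrite XE (partition_big (fun a : rk => a o) xpredT) //=.
  apply: eq_bigr => al _; rewrite -mulrA.
  have -> : \sum_(a : rk | a o == al) \prod_(l < d) term x a l
          = \sum_(a : rk | a o == al) F x a * H x a.
    by apply: eq_bigr => a _; rewrite (bigID (fun l : 'I_d => (l < k)%N)).
  rewrite separable_sum; first last.
  + move=> a b ab; apply: eq_bigr => l; rewrite -leqNgt => kl.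
    by rewrite /term !ab //= ltnW.
  + move=> a b ab; apply: eq_bigr => l lk.
    by rewrite /term !ab //= ltnW.
  (* If [N al = 0] no multi-index passes through [al], and both sides vanish. *)
  rewrite -mulr_natl mulrA -/(N al).
  have [N0|N0] := eqVneq (N al) 0; last by rewrite mulVf // mul1r.
  rewrite N0 mulr0 mul0r; apply: big_pred0 => a; apply/negbTE.
  move/eqP: N0; rewrite pnatr_eq0 => /eqP/card0_eq/(_ a).
  by rewrite inE => ->.
- move=> x y xy; apply/funext => al; congr (_ * _).
  by apply: eq_bigr => a _; apply: eq_bigr => l lk; rewrite /term xy.
- move=> x y xy; apply/funext => al.
  by apply: eq_bigr => a _; apply: eq_bigr => l; rewrite -leqNgt => lk; rewrite /term xy.
Qed.

(** The factorisation of [admits_TT_split] is a product of matrices of inner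
    dimension [r k]. The entries of the two factors are read off at any
    multi-index with the given row or column index, as the part that matters
    is determined by that index; rows and columns met by no multi-index are set
    to 0. *)
Lemma rank_unfold X k n : (k + n = d)%N -> admits_TT r X ->
  (\rank (unfold X k n) <= r k)%N.
Proof.
move=> kn XTT; have kd : (k <= d)%N by lia.
have [f [g [XE fE gE]]] := admits_TT_split kd XTT.
pose A : 'M[R]_(hdim p k, r k) := \matrix_(i, al)
  if [pick x | rowidx k x == i] is Some x then f x al else 0.
pose B : 'M[R]_(r k, tdim p k n) := \matrix_(al, j)
  if [pick y | colidx k y == j] is Some y then g y al else 0.
suff -> : unfold X k n = A *m B.
  by apply: leq_trans (mxrankM_maxl _ _) (rank_leq_col _).
apply/matrixP => i j; rewrite !mxE; under [RHS]eq_bigr do rewrite !mxE.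
case: pickP => [x /eqP xi|none]; last first.
  rewrite [RHS]big1 => [|al _]; last by rewrite mul0r.
  by apply: big_pred0 => x; rewrite none.
case: pickP => [y /eqP yj|none]; last first.
  rewrite [RHS]big1 => [|al _]; last by rewrite mulr0.
  by apply: big_pred0 => y; rewrite none andbF.
pose z : midx d p := splice k x y.
have zx (l : 'I_d) : (l < k)%N -> z l = x l by exact: splice_lt.
have zy (l : 'I_d) : (k <= l)%N -> z l = y l by exact: splice_ge.
rewrite -(fE _ _ zx) -(gE _ _ zy) -XE; apply: big_pred1 => w /=.
have zi : rowidx k z = i by rewrite -xi; apply: eq_bigr => l lk; rewrite zx.
have zj : colidx k z = j by rewrite -yj; apply: eq_bigr => l lk; rewrite zy.
apply/andP/eqP => [[/eqP wi /eqP wj]|->]; last by rewrite zi zj !eqxx.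
apply/ffunP => l; case: (ltnP l k) => lk.
  by apply: (rowidx_inj kd) => //; rewrite wi zi.
by apply: (colidx_inj kn) => //; rewrite wj zj.
Qed.

End TTRank.

(** * Loss caused by one truncation *)

Section Projections.
Variable R : realType.

Lemma sqnorm_splitr m n k (A : 'M[R]_(m, n)) (W : 'M_(n, k)) :
  W^T *m W = 1%:M ->
  sqnorm A = sqnorm (A *m (1%:M - W *m W^T)) + sqnorm (A *m W).
Proof.
move=> WW; rewrite -[LHS]sqnorm_tr (sqnorm_split _ WW).
rewrite -[X in X + _]sqnorm_tr -[X in _ + X]sqnorm_tr.
by rewrite !trmx_mul !trmxK linearB /= trmx1 trmx_mul trmxK.
Qed.

(** The error [(X + Z) *m P - X], with P the projection [W *m W^T], is the sum
    of [- X *m (1 - P)] and [Z *m P], which are orthogonal. *)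
Lemma projection_errorr m n k (X Z : 'M[R]_(m, n)) (W : 'M_(n, k)) :
  W^T *m W = 1%:M ->
  sqnorm ((X + Z) *m W *m W^T - X)
  = sqnorm X - sqnorm (X *m W) + sqnorm (Z *m W).
Proof.
move=> WW; rewrite (sqnorm_splitr X WW) addrK.
transitivity (sqnorm (- (X *m (1%:M - W *m W^T))) + sqnorm (Z *m W *m W^T));
    last first.
  rewrite sqnormN -[sqnorm (_ *m W^T)]sqnorm_tr trmx_mul trmxK.
  by rewrite (sqnorm_isometry _ WW) sqnorm_tr.
rewrite -sqnorm_pythagoras.
  congr sqnorm; rewrite mulmxBr mulmx1 opprB !mulmxDl !mulmxA addrAC -!addrA.
  by congr (_ + _); rewrite addrC.
rewrite trmx_mul trmxK mulNmx -!mulmxA (mulmxA _ W) mulmxBl mul1mx -mulmxA WW.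
by rewrite mulmx1 subrr mul0mx mulmx0 oppr0.
Qed.

Lemma projection_errorl m n k (X Z : 'M[R]_(m, n)) (W : 'M_(m, k)) :
  W^T *m W = 1%:M ->
  sqnorm (W *m (W^T *m (X + Z)) - X)
  = sqnorm X - sqnorm (W^T *m X) + sqnorm (W^T *m Z).
Proof.
move=> WW; rewrite -[LHS]sqnorm_tr -(sqnorm_tr X) -(sqnorm_tr (_ *m X)).
rewrite -(sqnorm_tr (_ *m Z)) !trmx_mul trmxK -projection_errorr //.
by rewrite linearB /= !trmx_mul trmxK linearD.
Qed.

(** [L^T *m (A + E)] has as many rows as [V] has columns, so that truncating it
    to its leading right singular vectors loses nothing. Hence the parts of
    [L^T *m A] and [L^T *m E] that [V] discards are opposite. *)
Lemma truncation_loss m n k (c : R) (L : 'M[R]_(m, k))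
    (A E : 'M_(m, n)) (V : 'M_(n, k)) :
  is_svdR (L^T *m (A + E)) V ->
  (forall N : 'M_n, c * sqnorm (A *m N) <= sqnorm (L^T *m A *m N)) ->
  c * (sqnorm A - sqnorm (A *m V)) <= sqnorm (L^T *m E).
Proof.
move=> /svdR_tr sV lowA; have VV := svdL_orthonormal sV.
rewrite (sqnorm_splitr A VV) addrK; apply: le_trans (lowA _) _.
have AE : L^T *m (A + E) *m (1%:M - V *m V^T) = 0.
  apply: trmx_inj; rewrite trmx_mul linearB /= trmx1 trmx_mul trmxK trmx0.
  rewrite mulmxBl mul1mx svdL_proj ?subrr //.
  by rewrite mxrank_tr rank_leq_row.
have -> : L^T *m A *m (1%:M - V *m V^T) = - (L^T *m E *m (1%:M - V *m V^T)).
  by apply/eqP; rewrite -addr_eq0 -mulmxDl -mulmxDr AE.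
by rewrite sqnormN [leRHS](sqnorm_splitr _ VV) lerDl sqnorm_ge0.
Qed.

Lemma truncation_lossl m n k (c : R) (W : 'M[R]_(n, k))
    (A E : 'M_(m, n)) (U : 'M_(m, k)) :
  is_svdL ((A + E) *m W) U ->
  (forall N : 'M_m, c * sqnorm (N *m A) <= sqnorm (N *m A *m W)) ->
  c * (sqnorm A - sqnorm (U^T *m A)) <= sqnorm (E *m W).
Proof.
move=> sU lowA; rewrite -(sqnorm_tr A) -(sqnorm_tr (_ *m A)) -(sqnorm_tr (_ *m W)).
rewrite !trmx_mul trmxK; apply: truncation_loss.
  by rewrite -linearD /= -trmx_mul; exact: svdL_tr.
move=> N; rewrite -(sqnorm_tr (_ *m N)) -[leRHS]sqnorm_tr !trmx_mul !trmxK.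
by rewrite mulmxA.
Qed.

Lemma const_mx1_mulT n : n = 1%N ->
  (const_mx 1 : 'M[R]_(1, n)) *m (const_mx 1)^T = 1%:M.
Proof. by move->; apply/matrixP => i j; rewrite !mxE big_ord1 !mxE !ord1 mulr1. Qed.

(** The empty sequential product, a 1 x 1 identity up to its type, preserves
    norms. *)
Lemma sqnorm_const_mx1_mull m n (A : 'M[R]_(1, m)) : n = 1%N ->
  sqnorm ((const_mx 1 : 'M_(1, n))^T *m A) = sqnorm A.
Proof. by move=> n1; rewrite sqnorm_isometry // trmxK const_mx1_mulT. Qed.

Lemma sqnorm_const_mx1_mulr m n (A : 'M[R]_(m, 1)) : n = 1%N ->
  sqnorm (A *m (const_mx 1 : 'M_(1, n))) = sqnorm A.
Proof.
move=> n1; rewrite -sqnorm_tr trmx_mul -[RHS]sqnorm_tr.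
exact: sqnorm_const_mx1_mull.
Qed.

Lemma const_mx1_Tmul n : n = 1%N ->
  (const_mx 1 : 'M[R]_(1, n))^T *m const_mx 1 = 1%:M.
Proof. by move->; apply/matrixP => i j; rewrite !mxE big_ord1 !mxE !ord1 mulr1. Qed.

Lemma le_expV_mul (c a b : R) k n : 0 < c <= 1 -> (k <= n)%N -> 0 <= b ->
  c ^+ k * a <= b -> a <= c ^- n * b.
Proof.
move=> /andP[c0 c1] kn b0 ab; have ck0 : 0 < c ^+ k by rewrite exprn_gt0.
have -> : a = c ^- k * (c ^+ k * a) by rewrite mulKf ?gt_eqF.
apply: le_trans (_ : c ^- k * b <= _).
  by rewrite ler_wpM2l // invr_ge0 ltW.
rewrite ler_wpM2r // lef_pV2 ?posrE ?exprn_gt0 //.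
by rewrite ler_wiXn2l // ltW.
Qed.

End Projections.

(** * Sequential products of factors *)

Section SequentialProducts.
Variables (R : realType) (d : nat) (p r : nat -> nat).
Implicit Types (X Y : tensor R d p) (U : lfactors R p r) (V : rfactors R p r).
Implicit Types (k n : nat).

Lemma lprod_orthonormal U k : r 0 = 1%N ->
  (forall i, (i < k)%N -> (U i)^T *m U i = 1%:M) ->
  (lprod U k)^T *m lprod U k = 1%:M.
Proof.
move=> r0; elim: k => [|k IH] UU /=; first exact: const_mx1_Tmul.
rewrite trmx_mul trmx_tens trmx1 -mulmxA (mulmxA _ _ (U k)) tensmx_mul mulmx1.
by rewrite IH => [|i /ltnW/UU //]; rewrite tensmx11 mul1mx UU.
Qed.

Lemma rprod_orthonormal V k n : r d = 1%N -> (k + n = d)%N ->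
  (forall i, (k <= i < d)%N -> (V i)^T *m V i = 1%:M) ->
  (rprod V k n)^T *m rprod V k n = 1%:M.
Proof.
move=> rd; elim: n k => [|n IH] k kn VV /=; first by apply: const_mx1_Tmul; rewrite -rd -kn addn0.
rewrite trmx_mul trmx_tens trmx1 -mulmxA (mulmxA _ _ (V k)) tensmx_mul mulmx1.
rewrite IH; [|by lia|by move=> i /andP[/ltnW ki id]; apply: VV; rewrite ki].
by rewrite tensmx11 mul1mx VV //; lia.
Qed.

Lemma lprodS_mulT U k n (A : 'M_(hdim p k.+1, n)) :
  (lprod U k.+1)^T *m A = (U k)^T *m ((1%:M *t (lprod U k)^T) *m A).
Proof. by rewrite /= trmx_mul trmx_tens trmx1 mulmxA. Qed.

(** The residuals computed by successive reshapes are the unfoldings of [Y]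
    compressed by the left product; only this form is used afterwards. *)
Lemma tresE Y U k n : (k + n = d)%N ->
  tres Y U k n = (lprod U k)^T *m unfold Y k n.
Proof.
elim: k n => [|k IH] n kn; first by rewrite /= trmx_const.
rewrite lprodS_mulT /= IH; last by lia.
by rewrite reshape_mull reshape_unfold //; lia.
Qed.

Lemma resE Y U k n : (k + n.+1 = d)%N ->
  res Y U k n = (1%:M *t (lprod U k)^T) *m unfold Y k.+1 n.
Proof. by move=> kn; rewrite /res tresE // reshape_mull reshape_unfold. Qed.

(** Each factor [U i] costs [1 - c ^+ 2]: the matrix whose singular space is
    [Ut i] has rank at most that of an unfolding of [X]. The arbitrary [N] on the
    right is what makes the induction go through the reshapes, since
    [N *t 1%:M] takes its place one step earlier. *)
Lemma lprod_lower X c U Ut k n q (N : 'M_(tdim p k n, q)) :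
  r 0 = 1%N -> admits_TT r X -> 0 < c < 1 ->
  (forall i, (i < d.-1)%N ->
    is_svdL ((1%:M *t (lprod U i)^T) *m unfold X i.+1 (d - i.+1)) (Ut i)) ->
  (forall i, (i < d.-1)%N -> sinTheta (U i) (Ut i) <= c) ->
  (k + n = d)%N -> (k <= d.-1)%N ->
  (1 - c ^+ 2) ^+ k * sqnorm (unfold X k n *m N)
  <= sqnorm ((lprod U k)^T *m unfold X k n *m N).
Proof.
move=> r0 XTT hc sU cU; elim: k n q N => [|k IH] n q N kn kd.
  by rewrite expr0 mul1r -[in leRHS]mulmxA sqnorm_const_mx1_mull.
have kn' : (k + n.+1 = d)%N by lia.
have kd' : (k <= d.-1)%N by lia.
have c2 : 0 <= 1 - c ^+ 2.
  by case/andP: hc => c0 c1; rewrite subr_ge0 expr_le1 // ltW.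
rewrite lprodS_mulT -(mulmxA (U k)^T).
pose M := (1%:M *t (lprod U k)^T) *m unfold X k.+1 n.
have sUk : is_svdL M (Ut k).
  by have := sU k kd; have -> : (d - k.+1 = n)%N by lia.
have rkM : (\rank M <= r k.+1)%N.
  by apply: leq_trans (mxrankM_maxr _ _) (rank_unfold kn XTT).
have WW : (Ut k)^T *m Ut k = 1%:M := svdL_orthonormal sUk.
have MN : Ut k *m (Ut k)^T *m (M *m N) = M *m N.
  by rewrite mulmxA svdL_proj.
apply: le_trans (sinTheta_lower hc (cU k kd) WW MN).
rewrite exprS -mulrA; apply: ler_wpM2l => //.
rewrite /M -!reshape_unfold // -reshape_mull -!reshape_mulr !sqnorm_reshape.
exact: (IH n.+1 _ (N *t 1%:M) kn' kd').
Qed.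

(** The mirror image of [lprod_lower], by induction on the number of right
    factors. *)
Lemma rprod_lower X c V Vt k n q (N : 'M_(q, hdim p k)) :
  r d = 1%N -> admits_TT r X -> 0 < c < 1 ->
  (forall i, (0 < i < d)%N ->
    is_svdR (unfold X i (d - i.+1).+1 *m (rprod V i.+1 (d - i.+1) *t 1%:M)) (Vt i)) ->
  (forall i, (0 < i < d)%N -> sinTheta (V i) (Vt i) <= c) ->
  (k + n = d)%N -> (0 < k)%N ->
  (1 - c ^+ 2) ^+ n * sqnorm (N *m unfold X k n)
  <= sqnorm (N *m unfold X k n *m rprod V k n).
Proof.
move=> rd XTT hc sV cV; elim: n k q N => [|n IH] k q N kn k0.
  by rewrite expr0 mul1r sqnorm_const_mx1_mulr // -rd -kn addn0.
have kd : (0 < k < d)%N by lia.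
have kn' : (k.+1 + n = d)%N by lia.
have c2 : 0 <= 1 - c ^+ 2.
  by case/andP: hc => c0 c1; rewrite subr_ge0 expr_le1 // ltW.
pose M := unfold X k n.+1 *m (rprod V k.+1 n *t 1%:M).
have /svdR_tr sVk : is_svdR M (Vt k).
  by have := sV k kd; have -> : (d - k.+1 = n)%N by lia.
rewrite /= !mulmxA.
have WW : (Vt k)^T *m Vt k = 1%:M := svdL_orthonormal sVk.
have rkM : (\rank M^T <= r k)%N.
  rewrite mxrank_tr; apply: leq_trans (mxrankM_maxl _ _) _.
  exact: rank_unfold.
have MN : Vt k *m (Vt k)^T *m (N *m M)^T = (N *m M)^T.
  by rewrite trmx_mul mulmxA svdL_proj.
rewrite -(mulmxA N) -/M -[leRHS]sqnorm_tr trmx_mul.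
apply: le_trans (sinTheta_lower hc (cV k kd) WW MN).
rewrite exprS -mulrA; apply: ler_wpM2l => //; rewrite sqnorm_tr.
rewrite -sqnorm_reshape -[leRHS]sqnorm_reshape /M mulmxA reshape_mulr.
by rewrite reshape_mull reshape_unfold //; apply: IH.
Qed.

(** The first norm on the left is that of [unfold X k n.+1 *m (W *t 1%:M)],
    reshaped, with [W] the product of the right factors after [k]; the difference
    is therefore the loss caused by [V k] alone. *)
Lemma backward_step X Z c U Ut V k n :
  r 0 = 1%N -> admits_TT r X -> 0 < c < 1 ->
  (forall i, (i < d.-1)%N ->
    is_svdL ((1%:M *t (lprod U i)^T) *m unfold X i.+1 (d - i.+1)) (Ut i)) ->
  (forall i, (i < d.-1)%N -> sinTheta (U i) (Ut i) <= c) ->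
  (k + n.+1 = d)%N -> (k <= d.-1)%N ->
  is_svdR (tres (X + Z) U k n.+1 *m (rprod V k.+1 n *t 1%:M)) (V k) ->
  (1 - c ^+ 2) ^+ k * (sqnorm (unfold X k.+1 n *m rprod V k.+1 n)
                       - sqnorm (unfold X k n.+1 *m rprod V k n.+1))
  <= sqnorm ((lprod U k)^T *m unfold Z k n.+1 *m (rprod V k.+1 n *t 1%:M)).
Proof.
move=> r0 XTT hc sU cU kn kd sV; set W := rprod V k.+1 n *t 1%:M.
have -> : unfold X k n.+1 *m rprod V k n.+1 = unfold X k n.+1 *m W *m V k.
  exact: mulmxA.
rewrite -(reshape_unfold X kn) -reshape_mulr sqnorm_reshape -/W -[in leRHS]mulmxA.
apply: truncation_loss.
  have -> : unfold X k n.+1 *m W + unfold Z k n.+1 *m W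
          = unfold (X + Z) k n.+1 *m W by rewrite unfoldD mulmxDl.
  by rewrite mulmxA -tresE.
move=> N; rewrite mulmxA -2![_ *m W *m N]mulmxA.
exact: lprod_lower sU cU kn kd.
Qed.

Lemma forward_step X Z c U V Vt k n :
  r d = 1%N -> admits_TT r X -> 0 < c < 1 ->
  (forall i, (0 < i < d)%N ->
    is_svdR (unfold X i (d - i.+1).+1 *m (rprod V i.+1 (d - i.+1) *t 1%:M)) (Vt i)) ->
  (forall i, (0 < i < d)%N -> sinTheta (V i) (Vt i) <= c) ->
  (k + n.+1 = d)%N -> is_svdL (res (X + Z) U k n *m rprod V k.+1 n) (U k) ->
  (1 - c ^+ 2) ^+ n * (sqnorm ((lprod U k)^T *m unfold X k n.+1)
                       - sqnorm ((lprod U k.+1)^T *m unfold X k.+1 n))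
  <= sqnorm ((1%:M *t (lprod U k)^T) *m unfold Z k.+1 n *m rprod V k.+1 n).
Proof.
move=> rd XTT hc sV cV kn sU; rewrite lprodS_mulT.
have -> : sqnorm ((lprod U k)^T *m unfold X k n.+1)
    = sqnorm ((1%:M *t (lprod U k)^T) *m unfold X k.+1 n).
  by rewrite -sqnorm_reshape reshape_mull reshape_unfold.
have kn' : (k.+1 + n = d)%N by lia.
apply: truncation_lossl.
  have -> : (1%:M *t (lprod U k)^T) *m unfold X k.+1 n
          + (1%:M *t (lprod U k)^T) *m unfold Z k.+1 n = res (X + Z) U k n
    by rewrite resE // unfoldD mulmxDr.
  exact: sU.
by move=> N; rewrite mulmxA; apply: rprod_lower sV cV kn' _.
Qed.

End SequentialProducts.

(** * Error bounds for the two updates *)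

Section Bounds.
Variables (R : realType) (d : nat) (p r : nat -> nat).
Variables (X Z : tensor R d p) (c : R).
Variables (U : lfactors R p r) (V : rfactors R p r).
Hypotheses (d2 : (2 <= d)%N) (r0 : r 0 = 1%N) (rd : r d = 1%N).
Hypotheses (XTT : admits_TT r X) (hc : 0 < c < 1).

Let c2 : 0 < 1 - c ^+ 2 <= 1.
Proof.
case/andP: hc => c0 c1; rewrite gerBl sqr_ge0 andbT subr_gt0.
by rewrite expr_lt1 // ltW.
Qed.

Let C : R := (1 - c ^+ 2) ^- d.

Let C1 : 1 <= C.
Proof.
by case/andP: c2 => h0 h1; rewrite /C invf_ge1 ?exprn_gt0 // exprn_ile1 // ltW.
Qed.

Lemma backward_bound (Xh : tensor R d p) (Ut : lfactors R p r) :
  (forall k, (0 < k < d)%N -> let n := (d - k.+1)%N in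
     is_svdR (tres (X + Z) U k n.+1 *m (rprod V k.+1 n *t 1%:M)) (V k)) ->
  unfold Xh 1 d.-1
    = unfold (X + Z) 1 d.-1 *m rprod V 1 d.-1 *m (rprod V 1 d.-1)^T ->
  (forall k, (k < d.-1)%N ->
     is_svdL ((1%:M *t (lprod U k)^T) *m unfold X k.+1 (d - k.+1)) (Ut k)) ->
  (forall k, (k < d.-1)%N -> sinTheta (U k) (Ut k) <= c) ->
  tnorm (Xh - X) ^+ 2
    <= C * (\sum_(k < d.-1) termA_bwd Z U V k + termB_bwd Z V).
Proof.
move=> sV XhE sU cU; have d1 : (1 + d.-1 = d)%N by lia.
have WW : (rprod V 1 d.-1)^T *m rprod V 1 d.-1 = 1%:M.
  apply: (rprod_orthonormal rd d1) => i id; have /svdR_tr := sV i id.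
  exact: svdL_orthonormal.
rewrite (tnorm_unfold _ d1) unfoldB XhE unfoldD (projection_errorr _ _ WW).
rewrite mulrDr lerD //; last first.
  by rewrite /termB_bwd fnorm_sqr ler_peMl ?sqnorm_ge0.
(* [h] grows from the compressed norm of [X] at 1 to its full norm at [d]. *)
pose h k := sqnorm (unfold X k (d - k) *m rprod V k (d - k)).
have hdE : sqnorm (unfold X 1 d.-1) = h d.
  rewrite -(tnorm_unfold _ d1) /h subnn /= sqnorm_const_mx1_mulr //.
  exact: tnorm_unfold (addn0 d).
have h1E : sqnorm (unfold X 1 d.-1 *m rprod V 1 d.-1) = h 1%N by rewrite /h subn1.
rewrite hdE h1E -telescope_sumr; last by lia.
rewrite big_add1 big_mkord mulr_sumr; apply: ler_sum => k _.
have kd : (0 < k.+1 < d)%N by have := ltn_ord k; lia.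
have kn : (k.+1 + (d - k.+2).+1 = d)%N by lia.
have knE : (d - k.+1 = (d - k.+2).+1)%N by lia.
rewrite /termA_bwd fnorm_sqr /h knE.
apply: (@le_expV_mul _ _ _ _ k.+1) => //; [by lia|exact: sqnorm_ge0|].
have kd1 : (k.+1 <= d.-1)%N by lia.
exact: (backward_step r0 XTT hc sU cU kn kd1 (sV _ kd)).
Qed.

Lemma forward_bound (Xh : tensor R d p) (Vt : rfactors R p r) :
  (forall k, (k < d.-1)%N -> let n := (d - k.+1)%N in
     is_svdL (res (X + Z) U k n *m rprod V k.+1 n) (U k)) ->
  unfold Xh d.-1 1 = lprod U d.-1 *m tres (X + Z) U d.-1 1 ->
  (forall k, (0 < k < d)%N -> let n := (d - k.+1)%N in
     is_svdR (unfold X k n.+1 *m (rprod V k.+1 n *t 1%:M)) (Vt k)) ->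
  (forall k, (0 < k < d)%N -> sinTheta (V k) (Vt k) <= c) ->
  tnorm (Xh - X) ^+ 2
    <= C * (\sum_(k < d.-1) termA_fwd Z U V k + termB_fwd Z U).
Proof.
move=> sU XhE sV cV; have d1 : (d.-1 + 1 = d)%N by lia.
have WW : (lprod U d.-1)^T *m lprod U d.-1 = 1%:M.
  by apply: lprod_orthonormal => // i id; exact: svdL_orthonormal (sU i id).
rewrite (tnorm_unfold _ d1) unfoldB XhE tresE // unfoldD (projection_errorl _ _ WW).
rewrite mulrDr lerD //; last first.
  by rewrite /termB_fwd fnorm_sqr ler_peMl ?sqnorm_ge0.
(* [h] decreases from the full norm of [X] at 0 to its compressed norm at
   [d.-1]. *)
pose h k := sqnorm ((lprod U k)^T *m unfold X k (d - k)).
have h0E : sqnorm (unfold X d.-1 1) = h 0%N.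
  rewrite -(tnorm_unfold _ d1) /h subn0 /= sqnorm_const_mx1_mull //.
  exact: tnorm_unfold (add0n d).
have hdE : sqnorm ((lprod U d.-1)^T *m unfold X d.-1 1) = h d.-1.
  by rewrite /h (_ : d - d.-1 = 1)%N //; lia.
rewrite h0E hdE -opprB -telescope_sumr // -sumrN big_mkord mulr_sumr.
apply: ler_sum => k _; rewrite opprB.
have kd : (k < d.-1)%N := ltn_ord k.
have kn : (k + (d - k.+1).+1 = d)%N by lia.
have knE : (d - k = (d - k.+1).+1)%N by lia.
rewrite /termA_fwd fnorm_sqr /h knE.
apply: (@le_expV_mul _ _ _ _ (d - k.+1)) => //; [by lia|exact: sqnorm_ge0|].
exact: (forward_step rd XTT hc sV cV kn (sU _ kd)).
Qed.

End Bounds.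

Theorem theorem3p1 (R : realType) (d : nat) (c0 : R)
    (hd : (2 <= d)%N) (hc0 : 0 < c0 < 1) :
  (exists C : R, 0 < C /\
    forall (p r : nat -> nat) (X Y Z : tensor R d p)
      (U : nat -> lfactors R p r) (V : nat -> rfactors R p r)
      (Xh : nat -> tensor R d p) (t : nat) (Ut : lfactors R p r),
    tt_dims d p r -> Y = X + Z -> admits_TT r X -> is_TTOI Y U V Xh ->
    (forall k, (k < d.-1)%N ->
       is_svdL ((1%:M *t (lprod (U t.*2) k)^T) *m unfold X k.+1 (d - k.+1)) (Ut k)) ->
    (forall k, (k < d.-1)%N -> sinTheta (U t.*2 k) (Ut k) <= c0) ->
    tnorm (Xh t.*2.+1 - X) ^+ 2 <=
      C * (\sum_(k < d.-1) termA_bwd Z (U t.*2) (V t.*2.+1) k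
           + termB_bwd Z (V t.*2.+1)))
  /\
  (exists C : R, 0 < C /\
    forall (p r : nat -> nat) (X Y Z : tensor R d p)
      (U : nat -> lfactors R p r) (V : nat -> rfactors R p r)
      (Xh : nat -> tensor R d p) (t : nat) (Vt : rfactors R p r),
    tt_dims d p r -> Y = X + Z -> admits_TT r X -> is_TTOI Y U V Xh ->
    (forall k, (0 < k < d)%N ->
       let n := (d - k.+1)%N in
       is_svdR (unfold X k n.+1 *m (rprod (V t.*2.+1) k.+1 n *t 1%:M)) (Vt k)) ->
    (forall k, (0 < k < d)%N -> sinTheta (V t.*2.+1 k) (Vt k) <= c0) ->
    tnorm (Xh t.*2.+2 - X) ^+ 2 <=
      C * (\sum_(k < d.-1) termA_fwd Z (U t.*2.+2) (V t.*2.+1) k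
           + termB_fwd Z (U t.*2.+2))).
Proof.
case/andP: (hc0) => c00 c01.
have C0 : 0 < (1 - c0 ^+ 2) ^- d.
  by rewrite invr_gt0 exprn_gt0 // subr_gt0 expr_lt1 // ltW.
split; exists ((1 - c0 ^+ 2) ^- d); split=> //.
- move=> p r X Y Z U V Xh t Ut [_ r0 rd _ _] -> XTT [_ bwd _] sU cU.
  have [|sV XhE] := bwd t.*2.+1; first by rewrite /= odd_double.
  exact: backward_bound XhE sU cU.
- move=> p r X Y Z U V Xh t Vt [_ r0 rd _ _] -> XTT [_ _ fwd] sV cV.
  have [//||sU XhE] := fwd t.*2.+2; first by rewrite /= odd_double.
  exact: forward_bound XhE sV cV.
Qed.
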